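(* There exists an absolute constant $c>0$ such that the following holds. Let $N, M$ be positive integers and let $a_{1},\ldots,a_{N}$ be positive integers (not necessarily distinct) with $a_{n}\leq M$ for all $1\leq n\leq N$. For $d\in\mathbb{N}$ set \[ \omega(d)=\#\{n\leq N:\ a_{n}\equiv 0 \pmod d\}. \] Let $\alpha\in(0,1]$, $y=\max\big((\ln M)^{\alpha},2\big)$, and let $\mathcal{D}$ be the set of square-free positive integers all of whose prime divisors lie in $(1,y]$ (so $1\in\mathcal{D}$). Suppose that $K>0$ is a constant (which may depend on $N$) and $g$ is a multiplicative function such that \[ \omega(n)\leq \frac{K}{g(n)}\quad\text{for every } n\in\mathcal{D}. \] Then for every $s\in\mathbb{N}$, \[ \sum_{n=1}^{N}\Big(\frac{a_{n}}{\varphi(a_{n})}\Big)^{s}\leq K\Big(\frac{c}{\alpha}\Big)^{s}\prod_{p\leq y}\Big(1+\frac{(1+p^{-1})^{s}-1}{g(p)}\Big), \] where the product is over primes $p\leq y$.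
   Context: $\varphi$ denotes Euler's totient function; $p$ always denotes a prime; $\ln$ is the natural logarithm. *)

(* Defs.v *)
From mathcomp Require Import all_boot all_order all_algebra.
From mathcomp Require Import reals exp.

Set Implicit Arguments.
Unset Strict Implicit.
Unset Printing Implicit Defensive.

Import Order.TTheory GRing.Theory Num.Theory.

Local Open Scope ring_scope.

(* 0 is not squarefree, since every d ^ 2 divides it. *)
Definition squarefree (n : nat) : Prop :=
  forall d : nat, (d ^ 2 %| n)%N -> d = 1%N.

(* The value g 0 is irrelevant: arithmetic functions live on positive
   integers. *)
Definition multiplicative_fun (R : realType) (g : nat -> R) : Prop :=
  g 1%N = 1 /\
  forall m n : nat, (0 < m)%N -> (0 < n)%N -> coprime m n ->
    g (m * n)%N = g m * g n.

Definition omega (N : nat) (a : 'I_N -> nat) (d : nat) : nat :=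
  #|[set n : 'I_N | (d %| a n)%N]|.

(* For M = 1, ln 1 = 0 and 0 `^ alpha = 0 (alpha != 0), so the value is 2. *)
Definition level (R : realType) (M : nat) (alpha : R) : R :=
  Num.max ((ln M%:R) `^ alpha) 2.

Definition smooth_squarefree (R : realType) (y : R) (n : nat) : Prop :=
  [/\ (0 < n)%N, squarefree n
    & forall p : nat, prime p -> (p %| n)%N -> p%:R <= y].

(* Main.v *)
(* Up to the factor 2, a / phi(a) is the product of 1 + 1/p over the primes p
   dividing a. Put x = ln M. At most x / ln 2 primes divide a, so those above x
   contribute at most exp (1 / ln 2). Those in (y, x] contribute O(ln x / ln y),
   which is O(1 / alpha), by an upper bound of Mertens type. The primes p <= y
   are kept: the s-th power of their product expands over the squarefree
   y-smooth divisors d of a, the sum over n turns each d into omega(d), and the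
   hypothesis on omega refactors the result as an Euler product. *)
Require Import Defs.
From mathcomp Require Import all_boot all_order all_algebra.
From mathcomp Require Import reals exp.
From mathcomp Require Import unstable sequences.
From mathcomp Require Import zify ring lra.

Set Implicit Arguments.
Unset Strict Implicit.
Unset Printing Implicit Defensive.

Import Order.TTheory GRing.Theory Num.Theory.

Local Open Scope ring_scope.

(** * A Mertens-type upper bound for primes in an interval *)

Section MertensInterval.
Variable R : realType.
Implicit Types (d : R) (m n p X Y : nat) (s : seq nat).

Lemma ln_prod_nat s (F : nat -> nat) : {in s, forall p, (0 < F p)%N} ->
  ln (\prod_(p <- s) F p)%:R = \sum_(p <- s) ln (F p)%:R :> R.
Proof.
move=> F_gt0; rewrite !big_seq.
suff [] : (0 < \prod_(p <- s | p \in s) F p)%N /\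
  ln (\prod_(p <- s | p \in s) F p)%:R =
    \sum_(p <- s | p \in s) ln (F p)%:R :> R by [].
elim/big_ind2: _ => [|m x n y [m0 <-] [n0 <-]|p /F_gt0 //]; first by rewrite ln1.
by rewrite muln_gt0 m0 n0 natrM lnM // posrE ltr0n.
Qed.

Lemma ln_fact_le n : (0 < n)%N -> ln (n`!)%:R <= n%:R * ln n%:R :> R.
Proof.
move=> n_gt0; rewrite mulr_natl -lnXn ?ltr0n//.
rewrite ler_ln ?posrE ?ltr0n ?exprn_gt0 ?ltr0n ?fact_gt0// -natrX ler_nat.
rewrite fact_prod -[X in (_ <= _ ^ X)%N](subn1 n.+1) // -prod_nat_const_nat.
by rewrite big_nat_cond [leqRHS]big_nat_cond leq_prod// => i; lia.
Qed.

(* The prime powers [p ^ (n %/ p)] all divide [n!], which is at most [n ^ n]. *)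
Lemma sum_ln_prime_div_le n s : (0 < n)%N -> uniq s ->
    {in s, forall p, prime p && (p <= n)%N} ->
  \sum_(p <- s) ln p%:R / p%:R <= 2 * ln n%:R :> R.
Proof.
move=> n_gt0 s_uniq sP.
have dvd_fact : (\prod_(p <- s) p ^ (n %/ p) %| n`!)%N.
  apply/Gauss_dvd_prod => [|p /sP /andP[p_pr _] _].
    rewrite filter_predT pairwise_map.
    apply/(@sub_in_pairwise _ (mem s) [rel x y | x != y]); last 2 first.
    - exact/allP.
    - by rewrite -uniq_pairwise.
    move=> p q /sP/andP[p_pr _] /sP/andP[q_pr _] /= pq.
    by rewrite coprimeXl// coprimeXr// prime_coprime// dvdn_prime2.
  rewrite pfactor_dvdn ?fact_gt0// logn_fact// big_nat_recl// expn1.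
  exact: leq_addr.
have n_gt0R : 0 < n%:R :> R by rewrite ltr0n.
rewrite -(ler_pM2l n_gt0R) mulrCA.
have -> : n%:R * (\sum_(p <- s) ln p%:R / p%:R) =
    \sum_(p <- s) n%:R * (ln p%:R / p%:R) :> R by rewrite mulr_sumr.
(* The factor 2 pays for the floor: [n / p <= 2 (n %/ p)] because [p <= n]. *)
apply: (@le_trans _ _ (\sum_(p <- s) 2 * ln (p ^ (n %/ p))%:R)).
  rewrite big_seq [leRHS]big_seq; apply: ler_sum => p /sP/andP[p_pr pn].
  have p_gt0 : 0 < p%:R :> R by rewrite ltr0n prime_gt0.
  rewrite natrX lnXn// -[_ *+ (n %/ p)]mulr_natl.
  have -> : n%:R * (ln p%:R / p%:R) = ln p%:R * (n%:R / p%:R) :> R by ring.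
  rewrite [leRHS]mulrA [leRHS]mulrC ler_wpM2l//.
    by rewrite ln_ge0// ler1n prime_gt0.
  rewrite ler_pdivrMr// -!natrM ler_nat.
  have := divn_eq n p; have := ltn_pmod n (prime_gt0 p_pr).
  have : (0 < n %/ p)%N by rewrite divn_gt0 ?prime_gt0.
  by set q := (n %/ p)%N; set r := (n %% p)%N; nia.
rewrite -mulr_sumr -ln_prod_nat => [|p /sP/andP[p_pr _]]; last first.
  by rewrite expn_gt0 prime_gt0.
rewrite ler_pM2l//; apply: le_trans (ln_fact_le n_gt0).
have fact0 := fact_gt0 n; have prod_gt0 := dvdn_gt0 fact0 dvd_fact.
rewrite ler_ln ?posrE ?ltr0n//.
by have := dvdn_leq fact0 dvd_fact; rewrite -(ler_nat R).
Qed.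

(** For [m > 0] this is [m ^ -(1 + d)], the general term of the zeta series at [1 + d]. *)
Definition zeta_term d m : R := expR (- ((1 + d) * ln m%:R)).

Lemma zeta_term_ge0 d m : 0 <= zeta_term d m.
Proof. exact: expR_ge0. Qed.

Lemma zeta_termM d m n : (0 < m)%N -> (0 < n)%N ->
  zeta_term d (m * n) = zeta_term d m * zeta_term d n.
Proof.
move=> m0 n0; rewrite /zeta_term natrM lnM ?posrE ?ltr0n//.
by rewrite -expRD -opprD -mulrDr.
Qed.

Lemma zeta_termE d m : (0 < m)%N ->
  zeta_term d m = m%:R^-1 * expR (- (d * ln m%:R)).
Proof.
move=> m0; rewrite /zeta_term mulrDl mul1r opprD expRD.
rewrite [expR (- ln _)]expRN lnK//.
by rewrite posrE ltr0n.
Qed.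

(** This is [ln (1 + x) <= x] at [x = - 1 / (m + 1)], where [1 + x = m / (m + 1)]. *)
Lemma invS_le_lnB m : (0 < m)%N ->
  m.+1%:R^-1 <= ln m.+1%:R - ln m%:R :> R.
Proof.
move=> m0; have mR : 0 < m%:R :> R by rewrite ltr0n.
have m1R : 0 < m.+1%:R :> R by rewrite ltr0n.
have e : m%:R / m.+1%:R = 1 + - m.+1%:R^-1 :> R.
  by rewrite -natr1; field; rewrite natr1 gt_eqF.
rewrite -[leRHS]opprB lerNr -ln_div ?posrE// e le_ln1Dx//.
by rewrite ltrN2 invf_lt1// ltr1n.
Qed.

(** The right-hand side is the integral of [t ^ -(1 + d)] over [[m, m + 1]], in a form that
    telescopes. It follows from [expR u >= 1 + u] with
    [u = d (ln (m + 1) - ln m) >= d / (m + 1)]. *)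
Lemma zeta_termS_le d m : 0 < d -> (0 < m)%N ->
  zeta_term d m.+1 <=
    d^-1 * (expR (- (d * ln m%:R)) - expR (- (d * ln m.+1%:R))).
Proof.
move=> d0 m0; rewrite zeta_termE//.
have -> : expR (- (d * ln m%:R)) =
    expR (- (d * ln m.+1%:R)) * expR (d * (ln m.+1%:R - ln m%:R)) :> R.
  by rewrite -expRD; congr expR; ring.
rewrite -{3}[expR (- (d * ln m.+1%:R))]mulr1 -mulrBr mulrCA mulrC.
rewrite ler_wpM2l ?expR_ge0// mulrC ler_pdivlMr//.
rewrite lerBrDl; apply: le_trans (expR_ge1Dx _).
by rewrite lerD2l mulrC ler_pM2l// invS_le_lnB.
Qed.

Lemma sum_zeta_term_nat_le d n : 0 < d ->
  \sum_(1 <= m < n.+1) zeta_term d m <= 1 + d^-1.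
Proof.
move=> d0; case: n => [|n].
  by rewrite big_geq// addr_ge0// invr_ge0 ltW.
(* Keeping the end term left by telescoping lets the induction close. *)
suff : \sum_(1 <= m < n.+2) zeta_term d m <=
    1 + d^-1 * (1 - expR (- (d * ln n.+1%:R))).
  move/le_trans; apply; rewrite lerD2l ler_piMr ?invr_ge0 ?ltW//.
  by rewrite ltrBlDr ltrDl expR_gt0.
elim: n => [|n IHn].
  by rewrite big_nat1 /zeta_term ln1 !mulr0 oppr0 expR0 subrr mulr0 addr0.
rewrite big_nat_recr//=; have := zeta_termS_le d0 (ltn0Sn n).
by move: IHn; rewrite !mulrBr; lra.
Qed.

Lemma sum_zeta_term_le d s : 0 < d -> uniq s -> {in s, forall m, (0 < m)%N} ->
  \sum_(m <- s) zeta_term d m <= 1 + d^-1.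
Proof.
move=> d0 s_uniq s_gt0.
apply: le_trans (sum_zeta_term_nat_le (\max_(m <- s) m) d0).
rewrite (perm_big [seq m <- index_iota 1 (\max_(m <- s) m).+1 | m \in s]).
  rewrite big_filter big_mkcond; apply: ler_sum => m _.
  by case: ifP => // _; exact: zeta_term_ge0.
apply: uniq_perm => // [|m]; first by rewrite filter_uniq ?iota_uniq.
rewrite mem_filter mem_index_iota; case: (boolP (m \in s)) => //= ms.
by rewrite s_gt0// ltnS (@leq_bigmax_seq _ _ xpredT id).
Qed.

(* Every product [m * \prod_(p in A) p] with [m <= Y] and [A] a subset of [s]
   determines [m] and [A], so expanding the left-hand side yields distinct
   terms. *)
Lemma zeta_term_expand d Y s : uniq s ->
    {in s, forall p, prime p && (Y < p)%N} ->
  exists t, [/\ uniq t, {in t, forall m, (0 < m)%N},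
    {in t, forall m p, prime p -> (Y < p)%N -> p \notin s -> ~~ (p %| m)%N} &
    (\sum_(1 <= m < Y.+1) zeta_term d m) * \prod_(p <- s) (1 + zeta_term d p) =
    \sum_(m <- t) zeta_term d m].
Proof.
elim: s => [_ _|q s IHs /= /andP[qs s_uniq] sP].
  exists (index_iota 1 Y.+1); split; first exact: iota_uniq.
  - by move=> m; rewrite mem_index_iota => /andP[].
  - move=> m; rewrite mem_index_iota => /andP[m0 mY] p _ Yp _.
    by apply/negP => /dvdn_leq -/(_ m0); lia.
  - by rewrite big_nil mulr1.
have [p ps|t [t_uniq t_gt0 tP tE]] := IHs s_uniq.
  by rewrite sP// inE ps orbT.
have /andP[q_pr Yq] : prime q && (Y < q)%N by rewrite sP// mem_head.
have q0 := prime_gt0 q_pr.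
(* The two halves come from the two terms of [1 + zeta_term d q]. They are disjoint because [q]
   exceeds [Y] and lies outside [s], so it divides no member of [t]. *)
exists (t ++ [seq (q * m)%N | m <- t]); split.
- rewrite cat_uniq t_uniq map_inj_uniq ?t_uniq ?andbT => [|m n /eqP]; last first.
    by rewrite eqn_pmul2l// => /eqP.
  apply/hasPn => _ /mapP[m mt ->] /=; apply/negP => /tP /(_ q q_pr Yq qs).
  by rewrite dvdn_mulr.
- move=> m; rewrite mem_cat => /orP[/t_gt0//|/mapP[n /t_gt0 n0 ->]].
  by rewrite muln_gt0 q0.
- move=> m mt p p_pr Yp; rewrite inE negb_or => /andP[pq ps].
  move: mt; rewrite mem_cat => /orP[/tP -> //|/mapP[n nt ->]].
  by rewrite Euclid_dvdM// negb_or dvdn_prime2// pq tP.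
- rewrite big_cons mulrCA tE big_cat/= big_map mulrDl mul1r mulr_sumr.
  congr (_ + _); rewrite big_seq [RHS]big_seq.
  by apply: eq_bigr => m /t_gt0 m0; rewrite zeta_termM.
Qed.

(** Each increment [ln (1 + 1 / (n + 1))] of the logarithm is at most [1 / (n + 1)]. *)
Lemma ln_le_sum_inv n : ln n.+1%:R <= \sum_(1 <= m < n.+1) m%:R^-1 :> R.
Proof.
elim: n => [|n IHn]; first by rewrite ln1 big_geq.
rewrite big_nat_recr//=.
have nR : 0 < n.+1%:R :> R by rewrite ltr0n.
have e : n.+2%:R = n.+1%:R * (1 + n.+1%:R^-1) :> R.
  by rewrite -(natr1 n.+1) mulrDr mulfV ?gt_eqF// mulr1.
have inv0 : 0 < n.+1%:R^-1 :> R by rewrite invr_gt0.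
rewrite e lnM ?posrE ?addr_gt0// lerD// le_ln1Dx//.
by rewrite (lt_trans _ inv0)// oppr_lt0.
Qed.

(* Rankin's trick: with exponent [1 + 1 / ln X] in place of [1], each [1 / m]
   with [m <= X] loses at most a factor [e] and the series is bounded by
   [1 + ln X]; the total loss on the primes is controlled by
   [sum_ln_prime_div_le]. *)
Lemma prod_prime_interval_le X Y s : (1 < X)%N -> (Y <= X)%N -> uniq s ->
    {in s, forall p, prime p && (Y < p <= X)%N} ->
  ln Y.+1%:R * \prod_(p <- s) (1 + p%:R^-1) <= expR 3 * (1 + ln X%:R) :> R.
Proof.
move=> X1 YX s_uniq sP.
have lnX0 : 0 < ln X%:R :> R by rewrite ln_gt0// ltr1n.
set d : R := (ln X%:R)^-1; have d0 : 0 < d by rewrite invr_gt0.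
have lnle m : (0 < m)%N -> (m <= X)%N -> d * ln m%:R <= 1.
  move=> m0 mX; rewrite mulrC ler_pdivrMr// mul1r ler_ln ?posrE ?ltr0n ?ler_nat//.
  by lia.
have HY : ln Y.+1%:R <= expR 1 * \sum_(1 <= m < Y.+1) zeta_term d m.
  apply: le_trans (ln_le_sum_inv Y) _; rewrite mulr_sumr.
  rewrite big_nat_cond [leRHS]big_nat_cond; apply: ler_sum => m.
  rewrite andbT => /andP[m0 mY]; rewrite zeta_termE// mulrCA ler_peMr ?invr_ge0//.
  by rewrite -expRD -[leLHS]expR0 ler_expR subr_ge0 lnle//; lia.
(* With [u = d ln p / p], the bound [p ^ -d >= 1 - d ln p] gives [1 / p <= zeta_term d p + u], hence
   [1 + 1 / p <= (1 + zeta_term d p) expR u]. The [u] sum to at most [2 d ln X = 2]; with the factor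
   [expR 1] of [HY] this makes [expR 3]. *)
have prodle : \prod_(p <- s) (1 + p%:R^-1) <=
    \prod_(p <- s) (1 + zeta_term d p) * expR 2 :> R.
  apply: (@le_trans _ _ (\prod_(p <- s)
      ((1 + zeta_term d p) * expR (d * (ln p%:R / p%:R))))).
    rewrite big_seq [leRHS]big_seq; apply: ler_prod => p /sP/and3P[p_pr _ pX].
    have p0 : 0 < p%:R^-1 :> R by rewrite invr_gt0 ltr0n prime_gt0.
    rewrite addr_ge0 ?(ltW p0)//=.
    have zp := zeta_term_ge0 d p.
    apply: (@le_trans _ _ ((1 + zeta_term d p) * (1 + d * (ln p%:R / p%:R)))).
      have u0 : 0 <= d * (ln p%:R / p%:R).
        rewrite mulr_ge0 ?(ltW d0)// mulr_ge0 ?(ltW p0)// ln_ge0// ler1n.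
        exact: prime_gt0.
      have : p%:R^-1 <= zeta_term d p + d * (ln p%:R / p%:R).
        rewrite zeta_termE ?prime_gt0//.
        have := ler_wpM2l (ltW p0) (expR_ge1Dx (- (d * ln p%:R))).
        by set e := expR _; lra.
      have := mulr_ge0 zp u0; set u := d * _; set z := zeta_term d p => zu hzu.
      by rewrite mulrDl mul1r mulrDr mulr1; lra.
    by rewrite ler_wpM2l ?expR_ge1Dx// addr_ge0.
  rewrite big_split/=; apply: ler_wpM2l.
    by apply: prodr_ge0 => p _; rewrite addr_ge0// zeta_term_ge0.
  rewrite -expR_sum ler_expR -mulr_sumr mulrC ler_pdivrMr//.
  apply: sum_ln_prime_div_le => // [|p /sP/and3P[-> _ ->]//]; first by lia.
have [p /sP/and3P[-> ->]//|t [t_uniq t_gt0 _ tE]] :=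
  @zeta_term_expand d Y s s_uniq _.
have tle := sum_zeta_term_le d0 t_uniq t_gt0.
have lnY0 : 0 <= ln Y.+1%:R :> R by rewrite ln_ge0// ler1n.
have prod0 : 0 <= \prod_(p <- s) (1 + p%:R^-1) :> R.
  by apply: prodr_ge0 => p _; rewrite addr_ge0// invr_ge0.
apply: le_trans (ler_pM lnY0 prod0 HY prodle) _.
rewrite mulrACA [leLHS](_ : _ = expR 1 * expR 2 *
  (\sum_(m <- t) zeta_term d m)); last by rewrite -tE; ring.
rewrite -expRD (_ : 1 + 2 = 3); last by ring.
by rewrite ler_wpM2l ?expR_ge0// (le_trans tle)// /d invrK.
Qed.

End MertensInterval.

(** * Reduction of [a / totient a] to the small prime factors of [a] *)

Section TotientRatio.
Variable R : realType.
Implicit Types (a k m n p M X Y : nat) (s : seq nat).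

Lemma prod_primes_logn a : (0 < a)%N ->
  (\prod_(p <- primes a) p ^ logn p a)%N = a.
Proof.
by move=> a0; rewrite {3}(prod_prime_decomp a0) prime_decompE big_map.
Qed.

Lemma totient_ratioE a : (0 < a)%N ->
  a%:R / (totient a)%:R = \prod_(p <- primes a) (p%:R / p.-1%:R) :> R.
Proof.
move=> a0; rewrite -{1}(prod_primes_logn a0) totientE// !natr_prod -prodf_div.
rewrite big_seq [RHS]big_seq; apply: eq_bigr => p.
rewrite mem_primes => /and3P[p_pr _ pa].
have p0 : p%:R != 0 :> R by rewrite pnatr_eq0 -lt0n prime_gt0.
have : (0 < logn p a)%N by rewrite logn_gt0 mem_primes p_pr a0.
case: (logn p a) => // k _.
by rewrite expnS !natrM -mulf_div divff ?mulr1// natrX expf_neq0.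
Qed.

(** The product telescopes, each factor being [m / (m - 1)] times [m / (m + 1)]. *)
Lemma prod_sqr_ratio_nat k : \prod_(2 <= m < k.+2) ((m ^ 2)%:R / (m ^ 2).-1%:R) =
  2 * k.+1%:R / k.+2%:R :> R.
Proof.
elim: k => [|k IHk]; first by rewrite big_geq// mulr1 divff ?pnatr_eq0.
rewrite big_nat_recr// IHk.
have -> : (k.+2 ^ 2).-1 = (k.+1 * k.+3)%N by lia.
rewrite natrX natrM -[k.+3%:R]natr1 -[k.+2%:R]natr1 -[k.+1%:R]natr1 /=.
by field; rewrite !natr1 !pnatr_eq0.
Qed.

(** All factors are at least 1, so the product may be extended to a full interval, where it
    telescopes to a value below 2. *)
Lemma prod_sqr_ratio_le2 s : uniq s -> {in s, forall m, (1 < m)%N} ->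
  \prod_(m <- s) ((m ^ 2)%:R / (m ^ 2).-1%:R) <= 2 :> R.
Proof.
move=> s_uniq s_gt1; set k := (\max_(m <- s) m)%N.
apply: (@le_trans _ _ (\prod_(2 <= m < k.+2) ((m ^ 2)%:R / (m ^ 2).-1%:R))).
  rewrite (perm_big [seq m <- index_iota 2 k.+2 | m \in s]).
    rewrite big_filter big_mkcond /= [leLHS]big_nat_cond [leRHS]big_nat_cond.
    apply: ler_prod => m; rewrite andbT => /andP[m2 _].
    have : 1 <= (m ^ 2)%:R / (m ^ 2).-1%:R :> R.
      by rewrite ler_pdivlMr ?mul1r ?ltr0n ?ler_nat; nia.
    by case: ifP => //= _ h; rewrite ?ler01//= (le_trans ler01 h)/=.
  apply: uniq_perm => // [|m]; first by rewrite filter_uniq ?iota_uniq.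
  rewrite mem_filter mem_index_iota; case: (boolP (m \in s)) => //= ms.
  by rewrite s_gt1// ltnS leqW// (@leq_bigmax_seq _ _ xpredT id).
rewrite prod_sqr_ratio_nat -mulrA ler_piMr// ler_pdivrMr ?ltr0n// mul1r ler_nat.
by [].
Qed.

Lemma totient_ratio_le a : (0 < a)%N ->
  a%:R / (totient a)%:R <= 2 * \prod_(p <- primes a) (1 + p%:R^-1) :> R.
Proof.
move=> a0; rewrite totient_ratioE//.
(* Factorwise, [p / (p - 1)] is [p ^ 2 / (p ^ 2 - 1)] times [1 + 1 / p]. *)
have -> : \prod_(p <- primes a) (p%:R / p.-1%:R) =
    \prod_(p <- primes a) ((p ^ 2)%:R / (p ^ 2).-1%:R) *
    \prod_(p <- primes a) (1 + p%:R^-1) :> R.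
  rewrite -big_split/= big_seq [RHS]big_seq; apply: eq_bigr => p.
  rewrite mem_primes => /and3P[/prime_gt1 + _ _].
  case: p => [|[|p]]// _.
  have -> : (p.+2 ^ 2).-1 = (p.+1 * p.+3)%N by lia.
  rewrite natrX natrM /= -[p.+3%:R]natr1 -[p.+2%:R]natr1 -[p.+1%:R]natr1.
  by field; rewrite !natr1 !pnatr_eq0.
rewrite ler_wpM2r//.
  by apply: prodr_ge0 => p _; rewrite addr_ge0// invr_ge0.
apply: prod_sqr_ratio_le2; first exact: primes_uniq.
by move=> p; rewrite mem_primes => /and3P[/prime_gt1].
Qed.

(** Each factor is at most [expR (1 / ln M)], and 2 to the number of primes dividing [a] is at most
    [a <= M]. *)
Lemma prod_large_primes_le M a (P : pred nat) :
    (0 < a <= M)%N -> (forall p, P p -> ln M%:R < p%:R :> R) ->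
  \prod_(p <- primes a | P p) (1 + p%:R^-1) <= expR (ln 2)^-1 :> R.
Proof.
move=> /andP[a0 aM] PM; have ln2 : 0 < ln 2 :> R by rewrite ln_gt0// ltr1n.
(* The case [M = 1] is split off because [ln M] vanishes there. *)
have [M1|M1] := leqP M 1.
  have -> : a = 1%N by lia.
  by rewrite big_nil -[leLHS]expR0 ler_expR invr_ge0 ltW.
have x0 : 0 < ln M%:R :> R by rewrite ln_gt0// ltr1n.
apply: (@le_trans _ _ (\prod_(p <- primes a) expR (ln M%:R)^-1)).
  rewrite big_mkcond; apply: ler_prod => p _.
  case: ifP => [/PM xp|_].
    have p0 := lt_trans x0 xp.
    have ip0 : 0 <= p%:R^-1 :> R by rewrite invr_ge0 ltW.
    rewrite addr_ge0//= (le_trans (expR_ge1Dx _))// ler_expR.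
    by rewrite lef_pV2 ?posrE// ltW.
  by rewrite ler01 -[leLHS]expR0 ler_expR invr_ge0 ltW.
rewrite big_const_seq iter_mulr_1 count_predT -expRM_natl ler_expR.
rewrite ler_pdivrMr// mulrC ler_pdivlMr// mulr_natl -lnXn// ler_ln ?posrE//.
- rewrite -natrX ler_nat (leq_trans _ aM)// -{2}(prod_primes_logn a0).
  rewrite -iter_muln_1 -(count_predT (primes a)) -big_const_seq.
  rewrite big_seq [leqRHS]big_seq; apply: leq_prod => p pa.
  have l0 : (0 < logn p a)%N by rewrite logn_gt0.
  have p_pr : prime p by move: pa; rewrite mem_primes => /andP[].
  by rewrite (leq_trans (prime_gt1 p_pr))// -{1}(expn1 p) leq_exp2l ?prime_gt1.
- by rewrite exprn_gt0.
- by rewrite ltr0n; lia.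
Qed.

Lemma prod_medium_primes_le M (alpha : R) s : (0 < M)%N -> 0 < alpha <= 1 ->
    uniq s -> {in s, forall p, prime p &&
      (Num.truncn (level M alpha) < p <= Num.truncn (ln M%:R : R))%N} ->
  \prod_(p <- s) (1 + p%:R^-1) <= expR 3 * (1 + (ln 2)^-1) / alpha.
Proof.
move=> M0 /andP[al0 al1] s_uniq.
set Y := Num.truncn (level M alpha); set X := Num.truncn (ln M%:R : R) => sP.
have ln2 : 0 < ln 2 :> R by rewrite ln_gt0// ltr1n.
(* If [X <= Y] the range is empty, and [alpha <= 1] makes the bound at least 1. *)
have [XY|YX] := leqP X Y.
  have -> : s = [::].
    by case: s sP {s_uniq} => // p s /(_ p (mem_head _ _)) /and3P[]; lia.
  rewrite big_nil ler_pdivlMr// mul1r (le_trans al1)//.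
  rewrite -[leLHS]mulr1 ler_pM//; last by rewrite lerDl invr_ge0 ltW.
  by rewrite -[leLHS]expR0 ler_expR.
have Y2 : (2 <= Y)%N.
  have lv : 2 <= level M alpha by rewrite /level le_max lexx orbT.
  by rewrite truncn_ge_nat// (le_trans _ lv).
have X1 : (1 < X)%N by lia.
have Xx : X%:R <= ln M%:R :> R.
  by rewrite truncn_le ln_ge0// ler1n.
have x0 : 0 < ln M%:R :> R by rewrite (lt_le_trans _ Xx)// ltr0n; lia.
have lnX : ln X%:R <= ln (ln M%:R) :> R by rewrite ler_ln// posrE ltr0n; lia.
(* Truncation may put [Y] below the level, but [Y + 1] is above it. Hence [L] dominates both [ln 2]
   and [alpha ln (ln M)], and dividing by [L] costs [1 / alpha]. *)
have lvY : level M alpha <= Y.+1%:R by rewrite ltW// truncnS_gt.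
set L : R := ln Y.+1%:R.
have L2 : ln 2 <= L by rewrite ler_ln ?posrE ?ltr0n// ler_nat; lia.
have Lal : alpha * ln (ln M%:R) <= L.
  rewrite -ln_powR ler_ln ?posrE ?powR_gt0 ?ltr0n// (le_trans _ lvY)//.
  by rewrite /level le_max lexx.
have L0 := lt_le_trans ln2 L2.
rewrite -(ler_pM2l L0).
apply: le_trans (prod_prime_interval_le R X1 (ltnW YX) s_uniq sP) _.
rewrite mulrCA -!mulrA ler_wpM2l ?expR_ge0// mulrCA.
have h1 : 1 <= L * (ln 2)^-1 by rewrite ler_pdivlMr// mul1r.
have h2 : ln X%:R <= L / alpha.
  by rewrite ler_pdivlMr// mulrC (le_trans _ Lal)// ler_pM2l.
have h3 : L * (ln 2)^-1 <= (ln 2)^-1 * (L / alpha).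
  by rewrite mulrC ler_pM2l ?invr_gt0// ler_pdivlMr// ler_piMr// ltW.
by rewrite mulrDl mul1r; lra.
Qed.

Lemma totient_ratio_small_primes_le M a (alpha : R) :
    (0 < a <= M)%N -> 0 < alpha <= 1 ->
  a%:R / (totient a)%:R <=
    2 * expR 3 * (1 + (ln 2)^-1) * expR (ln 2)^-1 / alpha *
    \prod_(p <- primes a | (p <= Num.truncn (level M alpha))%N) (1 + p%:R^-1).
Proof.
move=> /[dup] aM /andP[a0 a_leM] al.
set Y := Num.truncn (level M alpha); set X := Num.truncn (ln M%:R : R).
have F0 (P : pred nat) : 0 <= \prod_(p <- primes a | P p) (1 + p%:R^-1) :> R.
  by apply: prodr_ge0 => p _; rewrite addr_ge0// invr_ge0.
apply: le_trans (totient_ratio_le a0) _.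
(* Three ranges of primes: [A] up to [Y], [B] in [(Y, X]], [C] beyond both. *)
rewrite (bigID (fun p => p <= Y)%N)/=.
rewrite [X in _ * (_ * X)](bigID (fun p => p <= X)%N)/=.
set A := \prod_(p <- _ | _) _; set B := \prod_(p <- _ | _) _.
set C := \prod_(p <- _ | _) _.
have BE : B <= expR 3 * (1 + (ln 2)^-1) / alpha.
  rewrite /B -big_filter.
  apply: (@prod_medium_primes_le M) => //; first by lia.
    by rewrite filter_uniq ?primes_uniq.
  by move=> p; rewrite mem_filter mem_primes -ltnNge => /andP[-> /and3P[->]].
have CE : C <= expR (ln 2)^-1.
  apply: (prod_large_primes_le aM) => p /andP[_]; rewrite -ltnNge => Xp.
  by rewrite (lt_le_trans (truncnS_gt _))// ler_nat.
have := ler_pM (F0 _) (F0 _) BE CE; rewrite -/B -/C => BC.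
have -> : 2 * expR 3 * (1 + (ln 2)^-1) * expR (ln 2)^-1 / alpha * A =
  2 * (A * (expR 3 * (1 + (ln 2)^-1) / alpha * expR (ln 2)^-1)) by ring.
by rewrite ler_pM2l// ler_wpM2l// F0.
Qed.

End TotientRatio.

(** * Summation over [n] of products over small primes *)

Section SmallPrimes.
Variable R : realType.

Lemma smooth_squarefreeM (y : R) (q e : nat) : prime q -> q%:R <= y ->
  ~~ (q %| e)%N -> smooth_squarefree y e -> smooth_squarefree y (q * e)%N.
Proof.
move=> q_pr qy qe [e0 e_sqf e_le]; have q0 := prime_gt0 q_pr; split.
- by rewrite muln_gt0 q0.
- move=> d dqe; have [d1|d1|//] := ltngtP d 1.
    by move: d1 dqe; case: d => // _; rewrite dvd0n muln_eq0; lia.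
  (* It suffices to exclude the square of a prime [r] dividing [d]: if [r = q], cancelling [q] gives
     [q %| e]; otherwise [r ^ 2] divides [e]. *)
  have r_pr := pdiv_prime d1; set r := pdiv d in r_pr.
  have rqe : (r ^ 2 %| q * e)%N.
    by apply: dvdn_trans dqe; rewrite dvdn_exp2r ?pdiv_dvd.
  have [rq|rq] := eqVneq r q.
    by move: rqe qe; rewrite rq -mulnn dvdn_pmul2l// => ->.
  move: rqe; rewrite Gauss_dvdr => [/e_sqf r1|].
    by move: r_pr; rewrite r1.
  by rewrite coprimeXl// prime_coprime// dvdn_prime2.
- by move=> p p_pr; rewrite Euclid_dvdM// dvdn_prime2// => /orP[/eqP->|/e_le ->].
Qed.

(* Generalized over the divisibility condition [e] so that expanding the factor
   [1 + h q] of the first prime produces the same kind of sum for [q * e]. *)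
Lemma sum_prod_small_primes_le (N : nat) (a : 'I_N -> nat) (y K : R)
    (g h : nat -> R) (s : seq nat) (e : nat) :
    multiplicative_fun g ->
    (forall n, smooth_squarefree y n -> (omega a n)%:R <= K / g n) ->
    (forall p, 0 <= h p) ->
    uniq s -> {in s, forall p, [/\ prime p, p%:R <= y & ~~ (p %| e)%N]} ->
    smooth_squarefree y e ->
  \sum_(n < N | (e %| a n)%N) \prod_(p <- s | (p %| a n)%N) (1 + h p) <=
    K / g e * \prod_(p <- s) (1 + h p / g p).
Proof.
move=> [g1 gM] omega_le h0; elim: s e => [|q s IHs] e.
  move=> _ _ /omega_le; rewrite big_nil mulr1; apply: le_trans.
  under eq_bigr do rewrite big_nil.
  by rewrite sumr_const /omega -cardsE.
move=> /= /andP[qs s_uniq] sP eP.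
have [q_pr qy qe] := sP q (mem_head _ _).
have IHe := IHs e s_uniq _ eP.
have IHqe := IHs (q * e)%N s_uniq _ (smooth_squarefreeM q_pr qy qe eP).
have cop : coprime q e by rewrite prime_coprime.
(* Expand [1 + h q]: the term [h q] survives only when [q] divides [a n], which together with
   [e %| a n] means [q * e %| a n] by coprimality. *)
have -> : \sum_(n < N | (e %| a n)%N)
      \prod_(p <- q :: s | (p %| a n)%N) (1 + h p) =
    \sum_(n < N | (e %| a n)%N) \prod_(p <- s | (p %| a n)%N) (1 + h p) +
    h q * \sum_(n < N | (q * e %| a n)%N)
      \prod_(p <- s | (p %| a n)%N) (1 + h p).
  rewrite mulr_sumr [X in _ + X]big_mkcond [X in X + _]big_mkcond.
  rewrite [LHS]big_mkcond -big_split; apply: eq_bigr => n _ /=.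
  rewrite big_cons Gauss_dvd//.
  by case: (q %| a n)%N; case: (e %| a n)%N => /=; ring.
have e0 : (0 < e)%N by case: eP.
(* Multiplicativity of [g] recombines the bounds for [e] and [q * e] into the Euler factor at
   [q]. *)
have -> : K / g e * \prod_(p <- q :: s) (1 + h p / g p) =
    K / g e * \prod_(p <- s) (1 + h p / g p) +
    h q * (K / g (q * e)%N * \prod_(p <- s) (1 + h p / g p)).
  by rewrite big_cons gM ?(prime_gt0 q_pr)// invfM; ring.
rewrite lerD ?ler_wpM2l//.
  by apply: IHe => p ps; apply: sP; rewrite inE ps orbT.
apply: IHqe => p ps; have [|p_pr py pe] := sP p; first by rewrite inE ps orbT.
split=> //; rewrite Euclid_dvdM// negb_or pe andbT dvdn_prime2//.
by apply: contraNneq qs => <-.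
Qed.

End SmallPrimes.

(** * The moment bound for [a / totient a] *)

Theorem theorem1p1 (R : realType) :
  exists c : R, 0 < c /\
    forall (N M : nat) (a : 'I_N -> nat) (alpha K : R) (g : nat -> R),
      (0 < N)%N -> (0 < M)%N ->
      (forall n : 'I_N, (0 < a n <= M)%N) ->
      0 < alpha <= 1 ->
      0 < K ->
      multiplicative_fun g ->
      (forall n : nat, smooth_squarefree (level M alpha) n ->
         g n != 0 /\ (omega a n)%:R <= K / g n) ->
      forall s : nat,
        \sum_(n < N) ((a n)%:R / (totient (a n))%:R) ^+ s
        <= K * (c / alpha) ^+ s *
           \prod_(0 <= p < (Num.truncn (level M alpha)).+1 | prime p)
              (1 + ((1 + p%:R^-1) ^+ s - 1) / g p).
Proof.
have ln2 : 0 < ln 2 :> R by rewrite ln_gt0// ltr1n.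
(* The 2 compares [a / totient a] with the product of [1 + 1 / p], [expR 3 * (1 + (ln 2)^-1)] comes
   from the medium primes, and the last factor from the large ones. *)
set c : R := 2 * expR 3 * (1 + (ln 2)^-1) * expR (ln 2)^-1.
have c0 : 0 < c by rewrite !mulr_gt0 ?expR_gt0// addr_gt0// invr_gt0.
exists c; split => // N M a alpha K g N0 M0 aM al K0 gM omega_le s.
have al0 : 0 < alpha by case/andP: al.
set Y := Num.truncn (level M alpha).
(* With this choice [1 + h p] is the [s]-th power of [1 + 1 / p]. *)
pose h (p : nat) : R := (1 + p%:R^-1) ^+ s - 1.
have h0 p : 0 <= h p.
  by rewrite subr_ge0 exprn_ege1// lerDl invr_ge0.
pose ps := [seq p <- index_iota 0 Y.+1 | prime p].
have lv0 : 0 <= level M alpha by rewrite /level le_max ler0n orbT.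
(* At [e = 1] the divisibility condition is empty and [g 1 = 1]. *)
have := @sum_prod_small_primes_le R N a (level M alpha) K g h ps 1 gM.
case: gM => g1 _; rewrite g1 divr1 big_filter => small.
apply: (@le_trans _ _ (\sum_(n < N)
    (c / alpha) ^+ s * \prod_(p <- ps | (p %| a n)%N) (1 + h p))).
  apply: ler_sum => n _; have /andP[an0 _] := aM n.
  have := totient_ratio_small_primes_le (aM n) al; rewrite -/c -/Y.
  set A := \prod_(p <- _ | _) _ => leA.
  suff -> : \prod_(p <- ps | (p %| a n)%N) (1 + h p) = A ^+ s.
    by rewrite -exprMn lerXn2r// nnegrE ?divr_ge0// (le_trans _ leA)// divr_ge0.
  rewrite -prodrXl -!(big_filter _ (fun p => p %| a n)%N).
  rewrite -(big_filter _ (fun p => p <= Y)%N).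
  (* Both lists enumerate the primes up to [Y] that divide [a n]. *)
  rewrite (perm_big [seq p <- primes (a n) | (p <= Y)%N]).
    by apply: eq_bigr => p _; rewrite /h addrC subrK.
  apply: uniq_perm => [||p]; rewrite ?filter_uniq ?iota_uniq ?primes_uniq//.
  rewrite !mem_filter mem_index_iota mem_primes an0/= ltnS.
  by case: (p %| a n)%N; case: (prime p); case: (p <= Y)%N.
rewrite -mulr_sumr (mulrC K) -[leRHS]mulrA ler_wpM2l//.
  by rewrite exprn_ge0// divr_ge0 ?ltW.
apply: le_trans (small _ _ _ _ _) => //.
- by rewrite [leRHS](eq_bigl xpredT)// => n; rewrite dvd1n.
- by move=> n /omega_le[].
- by rewrite filter_uniq ?iota_uniq.
- move=> p; rewrite mem_filter mem_index_iota ltnS => /andP[p_pr pY].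
  split=> //; first by rewrite -truncn_ge_nat.
  by rewrite dvdn1; case: p p_pr {pY} => [|[]].
- split=> // [d|p p_pr]; first by rewrite dvdn1 => /eqP; nia.
  by rewrite dvdn1 => /eqP p1; rewrite p1 in p_pr.
Qed.
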